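(* For $n\ge 5$, $c_2(n,P_2)=0$, where $P_2$ is the $3$-graph with vertex set $\{v_1,\dots,v_5\}$ and edges $\{v_1,v_2,v_3\},\{v_3,v_4,v_5\}$ (the linear $2$-path).
   Context: For a $3$-graph $G$, $\delta_2(G)$ is the minimum over pairs of vertices of the number of edges containing the pair. $G$ has an $F$-covering if every vertex lies in a copy of $F$; $c_2(n,F)$ is the maximum of $\delta_2(G)$ over $n$-vertex $3$-graphs $G$ with no $F$-covering. *)

(* Defs.v *)
From mathcomp Require Import all_boot.
Set Implicit Arguments.
Unset Strict Implicit.
Unset Printing Implicit Defensive.

Definition uniform3 (T : finType) (E : {set {set T}}) : bool :=
  [forall e in E, #|e| == 3].

(* A 3-graph on the vertex set T is identified with its edge set. *)
Definition graph3 (T : finType) : Type := {E : {set {set T}} | uniform3 E}.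

Definition edges (T : finType) (G : graph3 T) : {set {set T}} := val G.

Definition codeg (T : finType) (G : graph3 T) (p : {set T}) : nat :=
  #|[set e in edges G | p \subset e]|.

(* The default #|T| of the minimum bounds every codegree of a pair, so it
   matters only when T has fewer than two elements (see delta2_attained). *)
Definition delta2 (T : finType) (G : graph3 T) : nat :=
  \big[minn/#|T|]_(p : {set T} | #|p| == 2) codeg G p.

(* A copy of F in G is a not necessarily induced subgraph isomorphic to F,
   given by an embedding f of its vertices. *)
Definition is_copy (S T : finType) (F : graph3 S) (G : graph3 T)
    (f : {ffun S -> T}) : bool :=
  injectiveb f && [forall e in edges F, f @: e \in edges G].

Definition has_covering (S T : finType) (F : graph3 S) (G : graph3 T) : bool :=
  [forall v : T, [exists f : {ffun S -> T}, is_copy F G f && (v \in codom f)]].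

(* The maximum of an empty family is 0 here; the family is nonempty as soon as
   0 < n and F has an edge (see c2_attained). *)
Definition c2 (n : nat) (S : finType) (F : graph3 S) : nat :=
  \max_(G : graph3 'I_n | ~~ has_covering F G) delta2 G.

Definition v1 : 'I_5 := inord 0.
Definition v2 : 'I_5 := inord 1.
Definition v3 : 'I_5 := inord 2.
Definition v4 : 'I_5 := inord 3.
Definition v5 : 'I_5 := inord 4.

Definition P2_edges : {set {set 'I_5}} :=
  [set [set v1; v2; v3]; [set v3; v4; v5]].

Lemma P2_uniform3 : uniform3 P2_edges.
Proof.
apply/forall_inP => e; rewrite !inE => /orP[] /eqP ->;
  by rewrite -setUA !cardsU1 !cards1 !inE -!val_eqE /= !inordK.
Qed.

Definition P2 : graph3 'I_5 := exist _ P2_edges P2_uniform3.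

Lemma codeg_le (T : finType) (G : graph3 T) (p : {set T}) :
  #|p| = 2 -> codeg G p <= #|T|.
Proof.
move=> p2; rewrite -cardsT.
have H e : e \in [set e in edges G | p \subset e] ->
    exists x, x \notin p /\ e = x |: p.
  rewrite inE => /andP[eG pe].
  have /eqP e3 : #|e| == 3 by move/forall_inP: (valP G) => /(_ e eG).
  have /eqP/cards1P[x ex] : #|e :\: p| = 1.
    by rewrite cardsD (setIidPr pe) e3 p2.
  exists x; split; last by rewrite -ex setUC -{1}(setIidPr pe) setID.
  by have := set11 x; rewrite -ex inE => /andP[].
apply: leq_trans (_ : #|(fun x => x |: p) @: [set: T]| <= _);
  last exact: leq_imset_card.
apply/subset_leq_card/subsetP => e /H[x [_ ->]].
by apply/imsetP; exists x.
Qed.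

Lemma delta2_attained (T : finType) (G : graph3 T) : 1 < #|T| ->
  (exists2 p : {set T}, #|p| = 2 & delta2 G = codeg G p) /\
  (forall p : {set T}, #|p| = 2 -> delta2 G <= codeg G p).
Proof.
move=> T2.
have lb (p : {set T}) : #|p| = 2 -> delta2 G <= codeg G p.
  move=> /eqP p2; rewrite /delta2; have := mem_index_enum p.
  elim: (index_enum _) => // q r IH; rewrite inE big_cons.
  case/orP=> [/eqP <-|/IH le_p]; first by rewrite p2 geq_minl.
  by case: ifP => // _; rewrite geq_min le_p orbT.
split=> //.
have /card_gt1P[x [y [_ _ xy]]] := T2.
have q2 : #|[set x; y]| = 2 by rewrite cards2 xy.
have [E|//] : delta2 G = #|T| \/
    exists2 p : {set T}, #|p| = 2 & delta2 G = codeg G p.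
  rewrite /delta2; elim/big_ind: _ => [|a b Ha Hb|p /eqP p2]; first by left.
  - by rewrite /minn; case: ifP.
  - by right; exists p.
exists [set x; y] => //; apply/eqP; rewrite eqn_leq lb //= E; exact: codeg_le.
Qed.

Lemma c2_attained (n : nat) (S : finType) (F : graph3 S) :
  0 < n -> edges F != set0 ->
  (exists2 G : graph3 'I_n, ~~ has_covering F G & delta2 G = c2 n F) /\
  (forall G : graph3 'I_n, ~~ has_covering F G -> delta2 G <= c2 n F).
Proof.
case: n => // n _ /set0Pn[e eF]; split; last first.
  by move=> G HG; rewrite /c2 (bigD1 G) //= leq_maxl.
have u0 : uniform3 (set0 : {set {set 'I_n.+1}}).
  by apply/forall_inP => x; rewrite inE.
pose G0 : graph3 'I_n.+1 := exist _ set0 u0.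
have G0P : ~~ has_covering F G0.
  apply/negP => /forallP/(_ ord0)/existsP[f /andP[/andP[_ /forall_inP/(_ e eF)]]].
  by rewrite inE.
rewrite /c2 (bigmax_eq_arg G0) //.
by case: arg_maxnP => // G HG _; exists G.
Qed.

(* Main.v *)
(* Suppose all codegrees are positive, fix a vertex v and suppose that v lies in
   no linear 2-path.  Any two edges through v then share a second vertex, and as
   n >= 5 the link of v contains a star with centre a and leaves b, c, d.
   An edge through the pair {b, c} meets one of the edges {v, a, b}, {v, a, d}
   in a single vertex, whatever its third vertex is. *)
Require Import Defs.
From mathcomp Require Import all_boot.

Set Implicit Arguments.
Unset Strict Implicit.
Unset Printing Implicit Defensive.

Lemma codeg_gt0 (T : finType) (G : graph3 T) (x y : T) :
  x != y -> 0 < codeg G [set x; y] ->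
  exists2 z, z \notin [:: x; y] & [set x; y; z] \in edges G.
Proof.
move=> xy /card_gt0P[e]; rewrite inE => /andP[eG sub].
have /eqP e3 : #|e| == 3 by move/forall_inP: (valP G) => /(_ e eG).
have /eqP/cards1P[z ez] : #|e :\: [set x; y]| = 1.
  by rewrite cardsD (setIidPr sub) e3 cards2 xy.
exists z; first by have := set11 z; rewrite -ez !inE => /andP[].
by rewrite -ez -{1}(setIidPr sub) setID.
Qed.

(** The list follows the order [v1], ..., [v5], so its third entry [x] is the shared vertex. As [v]
    may be any entry, it can be the centre or an end of the path. *)
Lemma P2_copy (T : finType) (G : graph3 T) (a b x c d v : T) :
  uniq [:: a; b; x; c; d] -> v \in [:: a; b; x; c; d] ->
  [set a; b; x] \in edges G -> [set x; c; d] \in edges G ->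
  exists f : {ffun 'I_5 -> T}, is_copy P2 G f && (v \in codom f).
Proof.
set s := [:: a; b; x; c; d] => s_uniq vs e1 e2.
(* The default [v] of [nth] is never returned, since the indices stay below 5. *)
pose f := [ffun i : 'I_5 => nth v s i]; exists f.
have fE k : k < 5 -> f (inord k) = nth v s k by move=> k5; rewrite ffunE inordK.
apply/andP; split; last first.
  have ks : index v s < 5 by rewrite index_mem.
  by rewrite -{1}(nth_index v vs) -(fE _ ks) codom_f.
apply/andP; split.
  apply/injectiveP => i j; rewrite !ffunE => /eqP.
  by rewrite nth_uniq // => /eqP/val_inj.
apply/forall_inP => e; rewrite !inE => /orP[] /eqP ->;
  by rewrite !imsetU !imset_set1 !fE.
Qed.

Lemma exists_notin (T : finType) (s : seq T) :
  size s < #|T| -> exists x, x \notin s.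
Proof.
move=> sT; apply/existsP; rewrite -negb_forall; apply: contraL sT => /forallP s_all.
rewrite -leqNgt; apply: leq_trans (card_size s).
by apply/subset_leq_card/subsetP => x _.
Qed.

Ltac distinct :=
  rewrite /= ?inE ?negb_or; repeat (apply/andP; split);
  solve [done | by rewrite eq_sym].

Lemma P2_covering (T : finType) (G : graph3 T) :
  4 < #|T| -> 0 < delta2 G -> has_covering P2 G.
Proof.
move=> T5 delta_gt0; apply/forallP => v; apply: contraT => /existsP no_copy.
have [_ delta_le] := delta2_attained G (leq_trans (isT : 1 < 5) T5).
pose E x y z := [set x; y; z] \in edges G.
have ext x y : x != y -> exists z, [/\ z != x, z != y & E x y z].
  move=> xy; have [|z] := @codeg_gt0 _ G x y xy.
    by apply: leq_trans delta_gt0 (delta_le _ _); rewrite cards2 xy.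
  by rewrite !inE negb_or => /andP[zx zy] Exyz; exists z.
have rot x y z : E x y z -> E y z x by move=> ?; rewrite /E setUC setUA.
have swap x y z : E x y z -> E y x z by rewrite /E (setUC [set x]).
have flip x y z : E x y z -> E x z y by rewrite /E setUAC.
have no_path a b x c d : uniq [:: a; b; x; c; d] -> v \in [:: a; b; x; c; d] ->
    E a b x -> E x c d -> False.
  by move=> s_uniq vs e1 e2; apply/no_copy/(P2_copy s_uniq vs e1 e2).
have fresh (s : seq T) : size s < 5 -> exists x, x \notin s.
  by move=> s5; apply: exists_notin; apply: leq_trans T5.
(* Extend the pair [v], [c] to an edge. A third vertex outside [a], [b] would give a linear path
   centred at [v]. *)
have meet a b c : a != v -> b != v -> c != v -> a != b -> a != c -> b != c ->
    E v a b -> E v a c \/ E v b c.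
  move=> av bv cv ab ac bc Eab; have [//|x [xv xc Ex]] := ext v c.
    by rewrite eq_sym.
  have [xa|xa] := eqVneq x a; first by left; apply: flip; rewrite -xa.
  have [xb|xb] := eqVneq x b; first by right; apply: flip; rewrite -xb.
  case: (no_path a b v c x); [by distinct| |exact: rot|by []].
  by rewrite !inE eqxx !orbT.
have [a0] := fresh [:: v] isT; rewrite inE => a0v.
have [|b0 [b0v b0a Eab0]] := ext v a0; first by rewrite eq_sym.
have [c] := fresh [:: v; a0; b0] isT.
rewrite !inE !negb_or => /and3P[cv ca0 cb0].
(* By [meet], [c] is joined to [a0] or [b0] in the link of [v]; call that one [a], the centre of the
   star. *)
have [a [b [[av bv ba] [ca cb] Eab Eac]]] : exists a b,
    [/\ [/\ a != v, b != v & b != a], c != a /\ c != b, E v a b & E v a c].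
  have [| | |Eac|Ebc] := meet a0 b0 c a0v b0v cv _ _ _ Eab0;
    try by rewrite eq_sym.
    by exists a0, b0.
  by exists b0, a0; do !split=> //; [rewrite eq_sym|exact: flip].
(* A vertex outside these four exists because there are at least five. *)
have [d] := fresh [:: v; a; b; c] isT.
rewrite !inE !negb_or => /and4P[dv da db dc].
(* The alternative left by [meet] is the edge [v], [b], [d], which meets the edge [v], [a], [c] only
   in [v]. *)
have Ead : E v a d.
  have [| | |//|Ebd] := meet a b d av bv dv _ _ _ Eab; try by rewrite eq_sym.
  case: (no_path b d v a c); [by distinct| |exact: rot|by []].
  by rewrite !inE eqxx !orbT.
have [|y [yb yc Ebcy]] := ext b c; first by rewrite eq_sym.
(* If [y] is [v] or [a], the path is centred at [y] and its second edge is [v], [a], [d]. *)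
exfalso; have [yv|yv] := eqVneq y v.
  subst y; apply: (no_path b c v a d) => //; first by distinct.
  by rewrite !inE eqxx !orbT.
have [ya|ya] := eqVneq y a.
  subst y; apply: (no_path b c a v d) => //; first by distinct.
    by rewrite !inE eqxx !orbT.
  exact: swap.
(* Now the centre is [b]. The case where [y] is [d] is included, as this path does not otherwise use
   [d]. *)
apply: (no_path v a b c y) => //; first by distinct.
by rewrite inE eqxx.
Qed.

Theorem theorem3 (n : nat) (hn : 5 <= n) : c2 n P2 = 0.
Proof.
apply/eqP; rewrite -leqn0; apply/bigmax_leqP => G; apply: contraR.
by rewrite -ltnNge => /P2_covering -> //; rewrite card_ord.
Qed.
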